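(* Let $2\le n\le\infty$. (i) For irreducible representations $\pi,\pi'$ of $\mathcal{O}_n$, if $\pi\sim\pi'$ (unitarily equivalent), then $\kappa(\pi)=\kappa(\pi')$. (ii) For any irreducible representation $\pi$ of $\mathcal{O}_n$ and any $g\in U(n)$, $\kappa(\pi\circ\alpha_g)=\kappa(\pi)$.
   Context: For $2\le n\le\infty$, $\mathcal{O}_n$ is the Cuntz algebra with Cuntz generators $s_1,\ldots,s_n$ (a sequence $s_1,s_2,\ldots$ if $n=\infty$): the universal unital C*-algebra generated by elements with $s_i^*s_j=\delta_{ij}I$ and $\sum_{i=1}^n s_is_i^*=I$ if $n<\infty$, respectively $\sum_{i=1}^k s_is_i^*\le I$ for all $k\geq 1$ if $n=\infty$. When $n=\infty$, $\{1,\ldots,n\}$ means $\{1,2,\ldots\}$. A representation of $\mathcal{O}_n$ means a unital $*$-representation on a Hilbert space. $U(n)$ is the rank $n$ unitary group when $n<\infty$, and the group of all unitaries on $\ell^2=\{(z_j)_{j\ge1}:\sum_{j}|z_j|^2<\infty\}$ when $n=\infty$; $\alpha$ is the $U(n)$-action on $\mathcal{O}_n$ by $*$-automorphisms with $\alpha_g(s_i)=\sum_{j=1}^n g_{ji}s_j$ for $g=(g_{ij})$ (norm-convergent sum if $n=\infty$). Let $\mathcal{I}_n=\bigcup_{l\ge0}\{1,\ldots,n\}^l$ be the set of finite words, $\{1,\ldots,n\}^0=\{\emptyset\}$, $s_J=s_{j_1}\cdots s_{j_l}$ for $J=(j_1,\ldots,j_l)$, $s_\emptyset=I$. For states $\omega,\omega'$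 on $\mathcal{O}_n$, write $\omega\sim\omega'$ if their GNS representations are unitarily equivalent. For a state $\omega$ with GNS representation $(\mathcal{H},\pi,\Omega)$, let $\mathcal{K}(\omega)$ be the closed linear span of $\{\pi(s_J)^*\Omega: J\in\mathcal{I}_n\}$ in $\mathcal{H}$, $\mathrm{c}\dim\omega:=\dim\mathcal{K}(\omega)\in\{1,2,\ldots,\infty\}$ (Hilbert space dimension), and $\kappa(\omega):=\min\{\mathrm{c}\dim\omega':\omega'\text{ a state on }\mathcal{O}_n,\ \omega'\sim\omega\}$. For an irreducible representation $(\mathcal{H},\pi)$ of $\mathcal{O}_n$, $\kappa(\pi):=\kappa(\omega_x\circ\pi)$, where $x\in\mathcal{H}$ is any unit vector and $\omega_x:=\langle x|(\cdot)x\rangle$; this does not depend on the choice of $x$, since $\omega_x\circ\pi\sim\omega_y\circ\pi$ for all unit vectors $x,y\in\mathcal{H}$. *)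

(* Defs.v *)
From HB Require Import structures.
From mathcomp Require Import all_boot all_order all_algebra.
From mathcomp Require Import all_classical all_reals all_analysis.
From mathcomp Require Import complex.

Set Implicit Arguments.
Unset Strict Implicit.
Unset Printing Implicit Defensive.

Import Order.TTheory GRing.Theory Num.Theory.
Import numFieldNormedType.Exports.

Local Open Scope classical_set_scope.
Local Open Scope ring_scope.

(* The complex field, kept as a structure so that its topology and conjugation
   are found by the generic [numClosedFieldType] instances. *)
Definition Cplx (R : realType) : numClosedFieldType := R[i].

(* Extended naturals are [option nat], with [None] standing for infinity. *)
Definition le_enat (m n : option nat) : bool :=
  match m, n with
  | _, None => true
  | None, Some _ => false
  | Some k, Some l => (k <= l)%N
  end.

(* Inner products are conjugate-linear in the first variable and linear in the
   second, as required for <x|(.)x> to be a linear functional. *)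
HB.mixin Record isHilbert (R : realType) H
    & CompleteNormedModule (Cplx R) H := {
  dot : H -> H -> Cplx R ;
  dot_linear : forall x, scalar (dot x) ;
  dotC : forall x y, dot y x = (dot x y)^* ;
  dot_norm : forall x, dot x x = `|x| ^+ 2 }.

#[short(type="hilbertType")]
HB.structure Definition Hilbert (R : realType) :=
  {H of isHilbert R H & CompleteNormedModule (Cplx R) H}.

(* Unital C*-algebras. The ring and normed hierarchies have no common
   refinement in the library, so the multiplication is added on top of the
   Banach space structure. *)
HB.mixin Record isCStar (R : realType) A & CompleteNormedModule (Cplx R) A := {
  cone : A ;
  cmul : A -> A -> A ;
  star : A -> A ;
  cmulA : associative cmul ;
  cmul1l : left_id cone cmul ;
  cmul1r : right_id cone cmul ;
  cmul_linearl : forall b, linear (fun a => cmul a b) ;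
  cmul_linearr : forall a, linear (cmul a) ;
  starK : involutive star ;
  starD : forall a b, star (a + b) = star a + star b ;
  starZ : forall (c : Cplx R) a, star (c *: a) = c^* *: star a ;
  starM : forall a b, star (cmul a b) = cmul (star b) (star a) ;
  cmul_norm_le : forall a b, `|cmul a b| <= `|a| * `|b| ;
  cmul_norm_star : forall a, `|cmul (star a) a| = `|a| ^+ 2 }.

#[short(type="cstarType")]
HB.structure Definition CStar (R : realType) :=
  {A of isCStar R A & CompleteNormedModule (Cplx R) A}.

Notation "a ** b" := (cmul a b) (at level 40, left associativity) : ring_scope.

Section HilbertGeometry.
Context {R : realType}.

Definition subspace (H : lmodType (Cplx R)) (V : set H) : Prop :=
  V 0 /\ forall (c : Cplx R) x y, V x -> V y -> V (c *: x + y).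

Definition lspan (H : lmodType (Cplx R)) (X : set H) : set H :=
  [set v | exists (k : nat) (c : 'I_k -> Cplx R) (x : 'I_k -> H),
     (forall i, X (x i)) /\ v = \sum_(i < k) c i *: x i].

Variable H : hilbertType R.

Definition orthonormal_basis (K B : set H) : Prop :=
  [/\ B `<=` K,
      forall e, B e -> `|e| = 1,
      forall e f, B e -> B f -> e <> f -> dot e f = 0
    & K `<=` closure (lspan B)].

(* Hilbert space dimension of a closed subspace, all infinite cardinals being
   identified. *)
Definition hdim (K : set H) : option nat :=
  xget None [set d | exists B, orthonormal_basis K B /\
    match d with Some k => (B #= `I_k)%card | None => infinite_set B end].

End HilbertGeometry.

Section Representations.
Context {R : realType}.

Definition star_morphism (A B : cstarType R) (f : A -> B) : Prop :=
  [/\ linear f, f cone = cone, (forall a b, f (a ** b) = f a ** f b)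
    & forall a, f (star a) = star (f a)].

Definition star_automorphism (A : cstarType R) (f : A -> A) : Prop :=
  star_morphism f /\ bijective f.

Variable A : cstarType R.

Definition positive_elt (a : A) : Prop := exists b, a = star b ** b.

Definition is_state (omega : A -> Cplx R) : Prop :=
  [/\ scalar omega, (forall a, 0 <= omega (star a ** a)) & omega cone = 1].

(* Unital *-representations: each [pi a] is a bounded operator on H. *)
Record representation (H : hilbertType R) (pi : A -> H -> H) : Prop := {
  rep_op_linear : forall a, linear (pi a) ;
  rep_op_bounded : forall a, continuous (pi a) ;
  rep_linear : forall (c : Cplx R) a b x, pi (c *: a + b) x = c *: pi a x + pi b x ;
  rep_mul : forall a b x, pi (a ** b) x = pi a (pi b x) ;
  rep_one : forall x, pi cone x = x ;
  rep_star : forall a x y, dot (pi (star a) x) y = dot x (pi a y) }.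

Definition irreducible (H : hilbertType R) (pi : A -> H -> H) : Prop :=
  [/\ representation pi,
      exists x : H, x <> 0
    & forall V : set H, subspace V -> closed V ->
        (forall a x, V x -> V (pi a x)) -> V = [set 0] \/ V = setT].

Definition unitarily_equivalent (H H' : hilbertType R)
    (pi : A -> H -> H) (pi' : A -> H' -> H') : Prop :=
  exists U : H -> H',
    [/\ linear U, bijective U, (forall x y, dot (U x) (U y) = dot x y)
      & forall a x, U (pi a x) = pi' a (U x)].

Definition vector_state (H : hilbertType R) (pi : A -> H -> H) (x : H) :
    A -> Cplx R := fun a => dot x (pi a x).

(* (H, pi, Omega) is a GNS triple of omega; it is unique up to unitary
   equivalence. *)
Definition is_GNS (omega : A -> Cplx R) (H : hilbertType R)
    (pi : A -> H -> H) (Omega : H) : Prop :=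
  [/\ representation pi,
      closure [set pi a Omega | a in [set: A]] = setT
    & forall a, omega a = dot Omega (pi a Omega)].

Definition state_equiv (omega omega' : A -> Cplx R) : Prop :=
  exists (H H' : hilbertType R) (pi : A -> H -> H) (pi' : A -> H' -> H')
         (Omega : H) (Omega' : H'),
    [/\ is_GNS omega pi Omega, is_GNS omega' pi' Omega'
      & unitarily_equivalent pi pi'].

End Representations.

Section UnitaryGroup.
Variable C : numClosedFieldType.

Definition l2 : set (nat -> C) :=
  [set x | cvgn (series (fun j => `|x j| ^+ 2 : C))].

Definition l2_dot (x y : nat -> C) : C :=
  limn (series (fun j => (x j)^* * y j)).

(* A unitary of l2 is represented by a map on all sequences of which only the
   restriction to [l2] matters. *)
Record l2_unitary (g : (nat -> C) -> (nat -> C)) : Prop := {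
  l2u_stable : forall x, l2 x -> l2 (g x) ;
  l2u_linear : forall (c : C) x y, l2 x -> l2 y ->
    g (fun j => c * x j + y j) = (fun j => c * g x j + g y j) ;
  l2u_dot : forall x y, l2 x -> l2 y -> l2_dot (g x) (g y) = l2_dot x y ;
  l2u_surj : forall y, l2 y -> exists2 x, l2 x & g x = y }.

Definition l2_entry (g : (nat -> C) -> (nat -> C)) (i j : nat) : C :=
  g (fun k => (k == j)%:R) i.

Definition unitary_group (n : option nat) : Type :=
  match n with
  | Some k => {g : 'M[C]_k | g \is unitarymx}
  | None => {g : (nat -> C) -> (nat -> C) | l2_unitary g}
  end.

End UnitaryGroup.

Definition cuntz_index (n : option nat) : eqType :=
  match n with Some k => 'I_k : eqType | None => nat : eqType end.

Section Cuntz.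
Context {R : realType}.

Definition cuntz_sum (A : cstarType R) (n : option nat) :
    (cuntz_index n -> A) -> Prop :=
  match n with
  | Some k => fun s => \sum_(i < k) s i ** star (s i) = cone
  | None => fun s => forall k : nat,
      positive_elt (cone - \sum_(i < k) s i ** star (s i))
  end.

Definition cuntz_relations (A : cstarType R) (n : option nat)
    (s : cuntz_index n -> A) : Prop :=
  (forall i j, star (s i) ** s j = if i == j then cone else 0) /\ cuntz_sum s.

Definition generated_by (A : cstarType R) (I : Type) (s : I -> A) : Prop :=
  forall B : set A, subspace B -> closed B -> B cone ->
    (forall a b, B a -> B b -> B (a ** b)) ->
    (forall a, B a -> B (star a)) ->
    (forall i, B (s i)) -> B = setT.

Definition is_cuntz_algebra (A : cstarType R) (n : option nat)
    (s : cuntz_index n -> A) : Prop :=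
  [/\ cuntz_relations s,
      generated_by s
    & forall (B : cstarType R) (t : cuntz_index n -> B), cuntz_relations t ->
        exists! f : A -> B, star_morphism f /\ forall i, f (s i) = t i].

(* f (s_i) = \sum_j g_ji s_j, the sum being norm-convergent for n = oo. *)
Definition generator_action (A : cstarType R) (n : option nat) :
    (cuntz_index n -> A) -> unitary_group (Cplx R) n -> (A -> A) -> Prop :=
  match n with
  | Some k => fun s g f => forall i, f (s i) = \sum_(j < k) sval g j i *: s j
  | None => fun s g f => forall i,
      series (fun j => l2_entry (sval g) j i *: s j) @ \oo --> f (s i)
  end.

(* [f] is the automorphism alpha_g. It is determined by [g] because the
   generators generate [A], and it exists by the universal property. *)
Definition is_alpha (A : cstarType R) (n : option nat)
    (s : cuntz_index n -> A) (g : unitary_group (Cplx R) n) (f : A -> A) : Prop :=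
  star_automorphism f /\ generator_action s g f.

Variables (A : cstarType R) (n : option nat) (s : cuntz_index n -> A).

Definition word (J : seq (cuntz_index n)) : A := \big[cmul/cone]_(j <- J) s j.

(* For a representation, [pi (star (word J))] is the adjoint of
   [pi (word J)]. *)
Definition Kspace (H : hilbertType R) (pi : A -> H -> H) (Omega : H) : set H :=
  closure (lspan [set pi (star (word J)) Omega | J in [set: seq (cuntz_index n)]]).

(* Well-defined by uniqueness of the GNS triple. *)
Definition cdim (omega : A -> Cplx R) : option nat :=
  xget None [set d | exists (H : hilbertType R) (pi : A -> H -> H) (Omega : H),
    is_GNS omega pi Omega /\ d = hdim (Kspace pi Omega)].

Definition is_min_enat (D : set (option nat)) (d : option nat) : Prop :=
  D d /\ forall d', D d' -> le_enat d d'.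

Definition kappa (omega : A -> Cplx R) : option nat :=
  xget None (is_min_enat
    [set cdim omega' | omega' in
       [set omega' | is_state omega' /\ state_equiv omega' omega]]).

(* The unit vector is an arbitrary choice; for irreducible [pi] the value does
   not depend on it. *)
Definition kappa_rep (H : hilbertType R) (pi : A -> H -> H) : option nat :=
  kappa (vector_state pi (xget 0 [set x : H | `|x| = 1])).

End Cuntz.

(* Main.v *)
Require Import Defs.
From mathcomp Require Import all_boot all_order all_algebra.
From mathcomp Require Import all_classical all_reals all_analysis.

Set Implicit Arguments.
Unset Strict Implicit.
Unset Printing Implicit Defensive.

Import Order.TTheory GRing.Theory Num.Theory.
Import numFieldNormedType.Exports Defs.

Local Open Scope classical_set_scope.
Local Open Scope ring_scope.

(** Why the theorem holds.

    Invariance under unitary equivalence. Every unit vector [x] of an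
    irreducible [pi] is cyclic, so [(H, pi, x)] is a GNS triple of its vector
    state. By uniqueness of GNS triples ([GNS_unique]) a state is therefore
    equivalent to that vector state exactly when its own GNS representation is
    unitarily equivalent to [pi] ([state_equiv_irreducible]). This condition
    is independent of [x] and depends only on the equivalence class of [pi], and
    [kappa] is determined by it.

    The intertwiner of two GNS triples with the same state is obtained as the
    closure in [H * H'] of the graph [pi a Omega |-> pi' a Omega']: this closure
    is a subspace on which both coordinates have the same norm, hence the graph
    of an isometry in either direction, and completeness makes it total.

    Invariance under [alpha_g]. Composition with [alpha_g] is a bijection of
    the states that preserves equivalence, so it suffices that it preserves
    [cdim], and for this that the isometries [t_i = alpha_g (s_i)] define the
    same space [K] as the [s_i]. Now [K] is the least closed subspace that
    contains [Omega] and is invariant under all [pi (s_j)^*]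
    ([Kspace_invariant], [Kspace_least]). Hence it is enough that [pi (t_i)^* y]
    lies in the closed span of the [pi (s_j)^* y], and conversely.

    Both follow from one computation in [A]. Let [v_j] be isometries with
    orthogonal ranges and [u] an isometry with [v_j^* u = c_j 1]. The residual
    [d = u - \sum_(j <- r) c_j v_j] satisfies
    [d^* d = (1 - \sum_(j <- r) |c_j|^2) 1] ([orthonormal_residual]). When
    [\sum_j |c_j|^2 = 1] this is arbitrarily small, and then so is
    [pi (d)^* y] ([rep_star_norm_le]). The coefficients [s_j^* t_i = g_ji] and
    [t_i^* s_j = conj g_ji] are the entries of the columns and of the rows of a
    unitary, so both families have unit norm ([alpha_coefficients]). *)

(** * Closed spans *)

Lemma closureP (K : numFieldType) (V : normedModType K) (X : set V) (v : V) :
  closure X v <-> forall e : K, 0 < e -> exists2 x, X x & `|v - x| < e.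
Proof.
split=> [Xv e e0|Xv B /nbhs_ballP[e /= e0 eB]].
  have [x [Xx]] := Xv _ (nbhsx_ballx v e e0).
  by rewrite -ball_normE /= => vx; exists x.
have [x Xx vx] := Xv e e0; exists x; split=> //; apply: eB.
by rewrite -ball_normE.
Qed.

Lemma continuous_image_closure (T U : topologicalType) (f : T -> U)
    (X : set T) (Y : set U) :
  continuous f -> (forall x, X x -> closure Y (f x)) ->
  forall x, closure X x -> closure Y (f x).
Proof.
move=> cf XY x Xx.
have : closed (f @^-1` closure Y).
  by apply: closed_comp => [y _|]; [exact: cf|exact: closed_closure].
move=> /closure_id cE; rewrite -[closure Y _]/((f @^-1` closure Y) x) cE.
exact: closure_subset Xx.
Qed.

Section Span.
Context {R : realType}.
Implicit Types V : normedModType (Cplx R).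

Lemma subspace_closure V (X : set V) : subspace X -> subspace (closure X).
Proof.
move=> [X0 XD]; split; first exact: subset_closure.
move=> c x y /closureP Xx /closureP Xy; apply/closureP => e e0.
have c0 : 0 < `|c| + 1 by rewrite ltr_wpDl.
have [x' Xx' xx'] := Xx (e / 2 / (`|c| + 1)) ltac:(by rewrite !divr_gt0).
have [y' Xy' yy'] := Xy (e / 2) ltac:(by rewrite divr_gt0).
exists (c *: x' + y'); first exact: XD.
rewrite opprD addrACA -scalerBr (le_lt_trans (ler_normD _ _))//.
rewrite [ltRHS]splitr ltr_leD//; last exact: ltW.
rewrite normrZ; move: xx'; rewrite ltr_pdivlMr// mulrC; apply: le_lt_trans.
by rewrite ler_wpM2r// lerDl.
Qed.

Lemma subspaceZ (V : lmodType (Cplx R)) (X : set V) c x : subspace X -> X x -> X (c *: x).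
Proof. by move=> [X0 XD] Xx; rewrite -[_ *: _]addr0; exact: XD. Qed.

Lemma subspaceD (V : lmodType (Cplx R)) (X : set V) x y :
  subspace X -> X x -> X y -> X (x + y).
Proof. by move=> [X0 XD] Xx Xy; rewrite -[x]scale1r; exact: XD. Qed.

Lemma subspace_sum (V : lmodType (Cplx R)) (X : set V) (I : eqType) (r : seq I)
    (f : I -> V) :
  subspace X -> (forall i, i \in r -> X (f i)) -> X (\sum_(i <- r) f i).
Proof.
move=> sX Xf; rewrite big_seq; apply: (big_ind X) => //; first by case: sX.
by move=> x y; exact: subspaceD.
Qed.

Lemma lspan_subset (V : lmodType (Cplx R)) (X Y : set V) :
  subspace Y -> X `<=` Y -> lspan X `<=` Y.
Proof.
move=> sY XY _ [k [c [x [Xx ->]]]]; apply: subspace_sum => // i _.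
by apply: subspaceZ => //; apply: XY.
Qed.

Lemma sub_lspan (V : lmodType (Cplx R)) (X : set V) : X `<=` lspan X.
Proof.
move=> x Xx; exists 1%N, (fun=> 1), (fun=> x); split=> //.
by rewrite big_ord1 scale1r.
Qed.

Lemma subspace_lspan (V : lmodType (Cplx R)) (X : set V) : subspace (lspan X).
Proof.
split; first by exists 0%N, (fun=> 0), (fun=> 0); split=> [[]//|]; rewrite big_ord0.
move=> a _ _ [k [c [x [Xx ->]]]] [l [d [y [Xy ->]]]].
exists (k + l)%N.
exists (fun i => match fintype.split i with inl i => a * c i | inr i => d i end).
exists (fun i => match fintype.split i with inl i => x i | inr i => y i end).
split; first by move=> i; case: fintype.splitP.
rewrite big_split_ord /= scaler_sumr; congr (_ + _); apply: eq_bigr => i _.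
  by rewrite (unsplitK (inl i)) scalerA.
by rewrite (unsplitK (inr i)).
Qed.

Lemma closed_span_subset V (X Y : set V) :
  subspace Y -> closed Y -> X `<=` Y -> closure (lspan X) `<=` Y.
Proof.
move=> sY cY XY; rewrite (closure_id Y).1//.
by apply: closure_subset; exact: lspan_subset.
Qed.

End Span.

(** * Inner products *)

Section InnerProduct.
Context {R : realType} {H : hilbertType R}.
Implicit Types (x y z : H) (c : Cplx R).

Lemma dotDr x y z : dot x (y + z) = dot x y + dot x z.
Proof. by have := dot_linear x 1 y z; rewrite scale1r mul1r. Qed.

Lemma dot0r x : dot x 0 = 0.
Proof. by apply: (addIr (dot x 0)); rewrite -dotDr !add0r. Qed.

Lemma dotZr x c y : dot x (c *: y) = c * dot x y.
Proof. by have /= := dot_linear x c y 0; rewrite dot0r !addr0. Qed.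

Lemma dotDl x y z : dot (y + z) x = dot y x + dot z x.
Proof. by rewrite (dotC x) dotDr rmorphD /= -(dotC x y) -(dotC x z). Qed.

Lemma dotZl x c y : dot (c *: y) x = c^* * dot y x.
Proof. by rewrite (dotC x) dotZr rmorphM /= -(dotC x y). Qed.

Lemma norm_sqrD x y : `|x + y| ^+ 2 = `|x| ^+ 2 + `|y| ^+ 2 + (dot x y + dot y x).
Proof. by rewrite -!dot_norm dotDl !dotDr [dot y x + _]addrC addrACA. Qed.

End InnerProduct.

(** Polarization: the real part of the inner product is read off from
    [|x + y|], and the imaginary part from the real part at ['i *: y]. *)
Lemma isometry_dot {R : realType} (H H' : hilbertType R) (U : H -> H') :
  linear U -> (forall x, `|U x| = `|x|) -> forall x y, dot (U x) (U y) = dot x y.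
Proof.
move=> linU nU x y.
have UD u v : U (u + v) = U u + U v by rewrite -[u]scale1r linU !scale1r.
have UZ c v : U (c *: v) = c *: U v.
  have U0 : U 0 = 0 by apply: (addIr (U 0)); rewrite add0r -UD addr0.
  by rewrite -[c *: v]addr0 linU U0 addr0.
have re u v : dot (U u) (U v) + dot (U v) (U u) = dot u v + dot v u.
  apply: (addrI (`|u| ^+ 2 + `|v| ^+ 2)).
  by rewrite -norm_sqrD -[in RHS]nU UD norm_sqrD !nU.
have im := re x ('i *: y); rewrite UZ !dotZr !dotZl conjCi !mulNr -!mulrBr in im.
move/(mulfI (neq0Ci (Cplx R))) in im.
have := congr2 +%R (re x y) im.
rewrite addrACA subrr addr0 [in RHS]addrACA subrr addr0 -!mulr2n.
by move/eqP; rewrite eqrMn2r => /eqP.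
Qed.

(** * Orthonormal families of isometries in a C*-algebra *)

Section CStarAlgebra.
Context {R : realType} {A : cstarType R}.
Implicit Types (a b : A) (c : Cplx R).

Lemma cmulDl a b d : (a + b) ** d = a ** d + b ** d.
Proof. by have /= := cmul_linearl d 1 a b; rewrite !scale1r. Qed.

Lemma cmul0l a : 0 ** a = 0.
Proof. by apply: (addIr (0 ** a)); rewrite -cmulDl !add0r. Qed.

Lemma cmulZl c a b : (c *: a) ** b = c *: (a ** b).
Proof. by have /= := cmul_linearl b c a 0; rewrite cmul0l !addr0. Qed.

Lemma cmulDr a b d : d ** (a + b) = d ** a + d ** b.
Proof. by have /= := cmul_linearr d 1 a b; rewrite !scale1r. Qed.

Lemma cmul0r a : a ** 0 = 0.
Proof. by apply: (addIr (a ** 0)); rewrite -cmulDr !add0r. Qed.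

Lemma cmulZr c a b : b ** (c *: a) = c *: (b ** a).
Proof. by have /= := cmul_linearr b c a 0; rewrite cmul0r !addr0. Qed.

Lemma cmulr_sumr (I : Type) (r : seq I) (f : I -> A) a :
  a ** (\sum_(i <- r) f i) = \sum_(i <- r) a ** f i.
Proof. by apply: (big_morph _ _ (cmul0r a)) => ? ?; rewrite cmulDr. Qed.

Lemma cmulr_continuous a : continuous (cmul a).
Proof.
move=> b; apply/cvgrPdist_lt => e e0.
have a0 : 0 < `|a| + 1 by rewrite ltr_wpDl.
have de0 : 0 < e / (`|a| + 1) by rewrite divr_gt0.
near=> d.
have bd : `|b - d| < e / (`|a| + 1) by near: d; exact: cvgr_dist_lt.
rewrite -scaleN1r -cmulZr -cmulDr scaleN1r (le_lt_trans (cmul_norm_le _ _))//.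
move: bd; rewrite ltr_pdivlMr// mulrC; apply: le_lt_trans.
by rewrite ler_wpM2r// lerDl.
Unshelve. all: by end_near. Qed.

Lemma star1 : star cone = cone :> A.
Proof. by rewrite -[star cone]cmul1r -{2}[cone]starK -starM cmul1r starK. Qed.

Lemma starN a : star (- a) = - star a.
Proof. by rewrite -[in LHS]scaleN1r starZ rmorphN rmorph1 scaleN1r. Qed.

Lemma star0 : star 0 = 0 :> A.
Proof. by apply: (addIr (star 0)); rewrite -starD !add0r. Qed.

Lemma star_sum (I : Type) (r : seq I) (f : I -> A) :
  star (\sum_(i <- r) f i) = \sum_(i <- r) star (f i).
Proof. by apply: (big_morph _ _ star0) => ? ?; rewrite starD. Qed.

Definition orthonormal_isometries (I : eqType) (v : I -> A) : Prop :=
  forall i j, star (v i) ** v j = if i == j then cone else 0.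

(** Bessel's identity with values in [A]: subtracting the terms one at a time,
    the coefficients of the indices not yet used are unchanged, and each
    subtraction lowers [star d ** d] by [`|c j| ^+ 2]. *)
Lemma orthonormal_residual (I : eqType) (v : I -> A) (u : A) (c : I -> Cplx R)
    (r : seq I) : uniq r ->
  orthonormal_isometries v ->
  star u ** u = cone -> (forall j, star (v j) ** u = c j *: cone) ->
  let d := u - \sum_(j <- r) c j *: v j in
  star d ** d = (1 - \sum_(j <- r) `|c j| ^+ 2) *: cone.
Proof.
move=> ur vv uu vu.
suff : let d := u - \sum_(j <- r) c j *: v j in
  star d ** d = (1 - \sum_(j <- r) `|c j| ^+ 2) *: cone /\
  forall j, j \notin r -> star (v j) ** d = c j *: cone by case.
elim: r ur => [_|j r IH /= /andP[jr /IH[IH1 IH2]]] /=.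
  by rewrite !big_nil !subr0 scale1r; split.
set d := u - _ in IH1 IH2.
have dE : u - \sum_(i <- j :: r) c i *: v i = d + (- c j) *: v j.
  by rewrite big_cons opprD [- _ - _]addrC addrA scaleNr.
(* Otherwise [cmulDr] would expand [d] itself as a sum. *)
clearbody d; rewrite !dE => {dE}; split=> [|i]; last first.
  rewrite inE negb_or => /andP[ij ir].
  by rewrite cmulDr cmulZr IH2// vv (negbTE ij) scaler0 addr0.
have dv : star d ** v j = (c j)^* *: cone.
  by rewrite -[LHS]starK starM starK IH2// starZ star1.
rewrite starD starZ cmulDl !cmulDr !cmulZr !cmulZl IH1 dv IH2// vv eqxx.
rewrite !scalerA -!scalerDl big_cons rmorphN /= normCK.
congr (_ *: _); rewrite !mulNr mulrN opprK [_^* * _]mulrC addNr addr0 opprD addrA.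
exact: addrAC.
Qed.

End CStarAlgebra.

(** * Families of scalars with unit square sum *)

(** The form in which [\sum_i `|c i| ^+ 2 = 1] enters the approximation below;
    finite subfamilies are duplicate-free lists so that finite and infinite
    index types are treated alike. *)
Definition near_unit_norm (R : realType) (I : eqType) (c : I -> Cplx R) : Prop :=
  forall e : Cplx R, 0 < e ->
    exists2 r : seq I, uniq r & `|1 - \sum_(j <- r) `|c j| ^+ 2| < e.

Lemma eq_near_unit_norm (R : realType) (I : eqType) (c d : I -> Cplx R) :
  (forall i, `|c i| = `|d i|) -> near_unit_norm c -> near_unit_norm d.
Proof.
move=> cd c1 e e0; have [r ur re] := c1 e e0; exists r => //.
by under eq_bigr do rewrite -cd.
Qed.

Lemma near_unit_norm_sum (R : realType) (I : finType) (c : I -> Cplx R) :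
  \sum_i `|c i| ^+ 2 = 1 -> near_unit_norm c.
Proof.
move=> c1 e e0; exists (index_enum I); first exact: index_enum_uniq.
by rewrite c1 subrr normr0.
Qed.

Lemma near_unit_norm_series (R : realType) (c : nat -> Cplx R) :
  series (fun j => `|c j| ^+ 2) @ \oo --> (1 : Cplx R) -> near_unit_norm c.
Proof.
move=> /cvgrPdist_lt c1 e /c1[N _ /(_ N (leqnn N))] /=; rewrite /series /=.
by exists (index_iota 0 N) => //; exact: iota_uniq.
Qed.

(** * Adjoints of isometries under a representation *)

Section Representation.
Context {R : realType} {A : cstarType R} {H : hilbertType R} (pi : A -> H -> H).
Hypothesis rpi : representation pi.
Implicit Types (a b : A) (c : Cplx R) (x y : H).

Lemma repD a b x : pi (a + b) x = pi a x + pi b x.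
Proof. by have := rep_linear rpi 1 a b x; rewrite !scale1r. Qed.

Lemma rep0 x : pi 0 x = 0.
Proof. by apply: (addIr (pi 0 x)); rewrite -repD !add0r. Qed.

Lemma repZ c a x : pi (c *: a) x = c *: pi a x.
Proof. by have := rep_linear rpi c a 0 x; rewrite rep0 !addr0. Qed.

Lemma repN a x : pi (- a) x = - pi a x.
Proof. by rewrite -[in LHS]scaleN1r repZ scaleN1r. Qed.

Lemma rep_sum (I : Type) (r : seq I) (f : I -> A) x :
  pi (\sum_(i <- r) f i) x = \sum_(i <- r) pi (f i) x.
Proof. by apply: (big_morph (fun a => pi a x) _ (rep0 x)) => ? ?; rewrite repD. Qed.

Lemma rep_opD a x y : pi a (x + y) = pi a x + pi a y.
Proof. by have := rep_op_linear rpi a 1 x y; rewrite !scale1r. Qed.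

Lemma rep_op0 a : pi a 0 = 0.
Proof. by apply: (addIr (pi a 0)); rewrite -rep_opD !add0r. Qed.

Lemma rep_opZ a c x : pi a (c *: x) = c *: pi a x.
Proof. by have /= := rep_op_linear rpi a c x 0; rewrite rep_op0 !addr0. Qed.

Lemma rep_norm_sqr a x : `|pi a x| ^+ 2 = dot x (pi (star a ** a) x).
Proof. by rewrite -dot_norm -{1}[a]starK (rep_star rpi) (rep_mul rpi). Qed.

(** [pi b] is [sqrt c] times an isometry, so its adjoint has norm at most
    [sqrt c]. With [z = pi (star b) y], expanding
    [0 <= `|c *: y - pi b z| ^+ 2 = c * (c * `|y| ^+ 2 - `|z| ^+ 2)] gives the
    bound for [c != 0]; for [c = 0] one has [pi b z = 0], so that
    [`|z| ^+ 2 = dot y (pi b z)] vanishes. *)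
Lemma rep_star_norm_le b c y : star b ** b = c *: cone ->
  `|pi (star b) y| ^+ 2 <= `|c| * `|y| ^+ 2.
Proof.
move=> bb.
have bE x : `|pi b x| ^+ 2 = c * `|x| ^+ 2.
  by rewrite rep_norm_sqr bb repZ (rep_one rpi) dotZr dot_norm.
have [->|y0] := eqVneq y 0; first by rewrite rep_op0 normr0 expr0n mulr0.
have c0 : 0 <= c.
  have : 0 <= c * `|y| ^+ 2 by rewrite -bE exprn_ge0.
  by rewrite pmulr_lge0// exprn_gt0// normr_gt0.
set z := pi (star b) y.
have yz : dot y (pi b z) = `|z| ^+ 2 by rewrite -(rep_star rpi) dot_norm.
have zy : dot (pi b z) y = `|z| ^+ 2.
  by rewrite (dotC y) yz geC0_conj ?exprn_ge0.
have : 0 <= `|c *: y + (-1) *: pi b z| ^+ 2 by rewrite exprn_ge0.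
rewrite norm_sqrD !normrZ normrN1 mul1r exprMn bE !dotZl !dotZr yz zy.
rewrite (ger0_norm c0).
have [c00|cn0] := eqVneq c 0.
  suff : pi b z = 0 by move=> z0 _; rewrite -yz z0 dot0r c00 mul0r.
  by apply/normr0_eq0/eqP; rewrite -sqrf_eq0 bE c00 mul0r.
rewrite (geC0_conj c0) rmorphN rmorph1 !mulN1r mulrN addrA addrK.
by rewrite expr2 -mulrA -mulrBr pmulr_rge0 ?subr_ge0// lt_def cn0.
Qed.

(** If [u = \sum_j c j *: v j] in the limit, then [pi (star u) y] is a limit of
    combinations of the [pi (star (v j)) y]. *)
Lemma rep_star_residual (I : eqType) (v : I -> A) (u : A) (c : I -> Cplx R)
    (y : H) (K : set H) :
  orthonormal_isometries v ->
  star u ** u = cone -> (forall j, star (v j) ** u = c j *: cone) ->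
  near_unit_norm c ->
  subspace K -> closed K -> (forall j, K (pi (star (v j)) y)) ->
  K (pi (star u) y).
Proof.
move=> vv uu vu c1 sK cK Ky; rewrite (closure_id K).1//.
apply/closureP => e e0.
(* The [+ 1] only keeps the denominator positive when [y = 0]. *)
have y0 : 0 < `|y| ^+ 2 + 1 by rewrite ltr_wpDl// exprn_ge0.
have [r ur re] := c1 (e ^+ 2 / (`|y| ^+ 2 + 1)) ltac:(by rewrite divr_gt0// exprn_gt0).
have dd := orthonormal_residual ur vv uu vu; rewrite /= in dd.
exists (\sum_(j <- r) (c j)^* *: pi (star (v j)) y).
  by apply: subspace_sum => // j _; exact: subspaceZ.
have := rep_star_norm_le y dd.
set d := u - _.
have -> : pi (star d) y = pi (star u) y - \sum_(j <- r) (c j)^* *: pi (star (v j)) y.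
  rewrite /d starD starN star_sum repD repN rep_sum; congr (_ - _).
  by apply: eq_bigr => j _; rewrite starZ repZ.
move=> dle; rewrite -(@ltr_pXn2r _ 2)// ?nnegrE ?(ltW e0)//.
rewrite (le_lt_trans dle)//; move: re; rewrite ltr_pdivlMr//; apply: le_lt_trans.
by rewrite ler_wpM2l// lerDl.
Qed.

End Representation.

(** * The space K as a least invariant closed subspace *)

Section Kspace.
Context {R : realType} {A : cstarType R} {n : option nat}.
Variables (H : hilbertType R) (pi : A -> H -> H) (Omega : H).
Hypothesis rpi : representation pi.
Variable s : cuntz_index n -> A.

(** Adjoints reverse words, so the invariance arguments extend words on the
    right: [star (s j) ** star (word s J)] is the adjoint of
    [word s (rcons J j)]. *)
Lemma word_rcons J j : word s (rcons J j) = word s J ** s j.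
Proof.
elim: J => [|i J IH]; rewrite /word /= !(big_nil, big_cons).
  by rewrite cmul1l cmul1r.
by rewrite -cmulA; congr (_ ** _).
Qed.

Lemma subspace_Kspace : subspace (Kspace s pi Omega).
Proof. exact/subspace_closure/subspace_lspan. Qed.

Lemma Kspace_Omega : Kspace s pi Omega Omega.
Proof.
apply/subset_closure/sub_lspan; exists [::] => //.
by rewrite /word big_nil star1 (rep_one rpi).
Qed.

Lemma Kspace_invariant j x :
  Kspace s pi Omega x -> Kspace s pi Omega (pi (star (s j)) x).
Proof.
apply: continuous_image_closure; first exact: (rep_op_bounded rpi).
move=> {}x /= Xx; apply/subset_closure; move: x Xx.
apply: lspan_subset.
  split; first by rewrite rep_op0//; exact: (subspace_lspan _).1.
  move=> c x y /= Xx Xy; rewrite rep_opD// rep_opZ//.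
  exact: (subspace_lspan _).2.
move=> _ [J _ <-] /=; apply: sub_lspan; exists (rcons J j) => //.
by rewrite word_rcons starM (rep_mul rpi).
Qed.

Lemma Kspace_least (K : set H) : subspace K -> closed K -> K Omega ->
  (forall j x, K x -> K (pi (star (s j)) x)) -> Kspace s pi Omega `<=` K.
Proof.
move=> sK cK KO Ks; apply: closed_span_subset => // _ [J _ <-].
elim/last_ind: J => [|J j IH]; first by rewrite /word big_nil star1 (rep_one rpi).
by rewrite word_rcons starM (rep_mul rpi); exact: Ks.
Qed.

End Kspace.

Section Coefficients.
Context {R : realType} {A : cstarType R} {n : option nat}.
Implicit Types s t : cuntz_index n -> A.

Lemma Kspace_subset s t c (H : hilbertType R) (pi : A -> H -> H) (Omega : H) :
  representation pi -> orthonormal_isometries s -> orthonormal_isometries t ->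
  (forall i j, star (s j) ** t i = c i j *: cone) ->
  (forall i, near_unit_norm (c i)) ->
  Kspace t pi Omega `<=` Kspace s pi Omega.
Proof.
move=> rpi ss tt st c1; apply: Kspace_least => //.
- exact: subspace_Kspace.
- exact: closed_closure.
- exact: Kspace_Omega.
- move=> i x Kx.
  apply: (rep_star_residual rpi ss _ (st i) (c1 i)).
  + by rewrite tt eqxx.
  + exact: subspace_Kspace.
  + exact: closed_closure.
  + by move=> j; exact: Kspace_invariant.
Qed.

Lemma Kspace_eq s t c (H : hilbertType R) (pi : A -> H -> H) (Omega : H) :
  representation pi -> orthonormal_isometries s -> orthonormal_isometries t ->
  (forall i j, star (s j) ** t i = c i j *: cone) ->
  (forall i, near_unit_norm (c i)) -> (forall j, near_unit_norm (c^~ j)) ->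
  Kspace t pi Omega = Kspace s pi Omega.
Proof.
move=> rpi ss tt st c1 c2; apply/seteqP; split; first exact: (@Kspace_subset _ _ c).
apply: (@Kspace_subset _ _ (fun j i => (c i j)^*)) => // [j i|j].
  by rewrite -[LHS]starK starM starK st starZ star1.
by apply: eq_near_unit_norm (c2 j) => i; rewrite norm_conjC.
Qed.

End Coefficients.

(** * Coefficients of rotated Cuntz generators *)

Section AlphaCoefficients.
Context {R : realType} {A : cstarType R}.
Notation C := (Cplx R).

(** [c i j] is the [(j, i)] entry of a unitary; of its unitarity only the unit
    norm of every column and every row is recorded. *)
Definition has_unitary_coefficients n (s t : cuntz_index n -> A) : Prop :=
  exists c : cuntz_index n -> cuntz_index n -> C,
    [/\ forall i j, star (s j) ** t i = c i j *: cone,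
        forall i, near_unit_norm (c i) & forall j, near_unit_norm (c^~ j)].

Lemma finite_coefficients k (s t : cuntz_index (Some k) -> A) (g : 'M[C]_k) :
  orthonormal_isometries s -> g \is unitarymx ->
  (forall i, t i = \sum_(j < k) g j i *: s j) ->
  has_unitary_coefficients s t.
Proof.
move=> ss gu tE; exists (fun i j => g j i); split=> [i j|i|j].
- rewrite tE cmulr_sumr (bigD1 j)//= big1 => [|l lj].
    by rewrite cmulZr ss eqxx addr0.
  by rewrite cmulZr ss eq_sym (negbTE lj) scaler0.
- apply: near_unit_norm_sum.
  have /unitarymxP/mulmx1C/matrixP/(_ i i) := gu.
  rewrite !mxE eqxx; apply: etrans; apply: eq_bigr => j _.
  by rewrite !mxE normCK mulrC.
- apply: near_unit_norm_sum.
  have /unitarymxP/matrixP/(_ j j) := gu.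
  rewrite !mxE eqxx; apply: etrans; apply: eq_bigr => i _.
  by rewrite !mxE normCK.
Qed.

Lemma series_delta (V : normedModType C) (f : nat -> V) (j : nat) :
  (forall i, i != j -> f i = 0) -> series f @ \oo --> f j.
Proof.
move=> f0; apply: cvg_near_cst; exists j.+1 => // N /= jN.
rewrite /series /= big_mkord (bigD1 (Ordinal jN))//= big1 ?addr0// => i ij.
by apply: f0; rewrite -val_eqE in ij.
Qed.

Lemma l2_dot_delta (x : nat -> C) k : l2_dot (fun j => (j == k)%:R) x = x k.
Proof.
apply: cvg_lim => //; have /= := @series_delta C^o (fun j => ((j == k)%:R)^* * x j) k.
rewrite eqxx rmorph1 mul1r; apply => i /negbTE ->.
by rewrite rmorph0 mul0r.
Qed.

Lemma l2_delta k : l2 (fun j => (j == k)%:R : C).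
Proof.
have lim := @series_delta C^o (fun j => (j == k)%:R) k.
have dE : (fun j => `|(j == k)%:R : C| ^+ 2) = (fun j => (j == k)%:R).
  by apply/funext => j; rewrite normr_nat; case: (j == k); rewrite ?expr1n ?expr0n.
rewrite /l2 /= dE; have {}lim := cvgP _ (lim _).
by apply: lim => i /negbTE ->.
Qed.

Lemma l2_dot_self (x : nat -> C) : l2 x ->
  series (fun j => `|x j| ^+ 2) @ \oo --> l2_dot x x.
Proof.
move=> l2x; rewrite /l2_dot.
have -> : (fun j => (x j)^* * x j) = (fun j => `|x j| ^+ 2 : C).
  by apply/funext => j; rewrite normCK mulrC.
exact: l2x.
Qed.

Lemma l2_dot_deltar (x : nat -> C) k : l2_dot x (fun j => (j == k)%:R) = (x k)^*.
Proof.
apply: cvg_lim => //; have /= := @series_delta C^o (fun j => (x j)^* * (j == k)%:R) k.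
by rewrite eqxx mulr1; apply => i /negbTE ->; rewrite mulr0.
Qed.

(** With [delta i] the [i]-th basis vector, [x i] is the inner product of
    [delta i] and [x], hence of [g (delta i)] and [g x = delta j]. So a row of
    [g] has the norm of the preimage of a basis vector, which is [1]. *)
Lemma l2_unitary_preimage_delta (g : (nat -> C) -> nat -> C) (x : nat -> C) j :
  l2_unitary g -> l2 x -> g x = (fun i => (i == j)%:R) ->
  forall i, (l2_entry g j i)^* = x i.
Proof.
move=> gu l2x gx i; transitivity (l2_dot (g (fun k => (k == i)%:R)) (g x)).
  by rewrite gx l2_dot_deltar.
by rewrite (l2u_dot gu (@l2_delta i) l2x) l2_dot_delta.
Qed.

Lemma infinite_coefficients (s t : cuntz_index None -> A)
    (g : (nat -> C) -> nat -> C) :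
  orthonormal_isometries s -> l2_unitary g ->
  (forall i, series (fun j => l2_entry g j i *: s j) @ \oo --> t i) ->
  has_unitary_coefficients s t.
Proof.
move=> ss gu tE; exists (fun i j => l2_entry g j i); split=> [i j|i|j].
- have lim1 : series (fun l => star (s j) ** (l2_entry g l i *: s l)) @ \oo -->
      star (s j) ** t i.
    rewrite (_ : series _ =
      cmul (star (s j)) \o series (fun l => l2_entry g l i *: s l)).
      exact: cvg_comp (tE i) (@cmulr_continuous _ _ (star (s j)) (t i)).
    by apply/funext => N; rewrite /series /= cmulr_sumr.
  have := @series_delta A (fun l => star (s j) ** (l2_entry g l i *: s l)) j.
  rewrite cmulZr ss eqxx => lim2; apply: (cvg_unique _ lim1) => //.
  by apply: lim2 => l lj; rewrite cmulZr ss eq_sym (negbTE lj) scaler0.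
- apply: near_unit_norm_series; rewrite /l2_entry.
  have := l2_dot_self (l2u_stable gu (@l2_delta i)).
  by rewrite (l2u_dot gu) ?l2_dot_delta ?eqxx//; exact: l2_delta.
- have [x l2x gx] := l2u_surj gu (@l2_delta j).
  apply: (@eq_near_unit_norm _ _ x) => [i|].
    by rewrite -(l2_unitary_preimage_delta gu l2x gx) norm_conjC.
  apply: near_unit_norm_series; have := l2_dot_self l2x.
  by rewrite -(l2u_dot gu l2x l2x) gx l2_dot_delta eqxx.
Qed.

End AlphaCoefficients.

(** * Uniqueness of GNS triples *)

Section GNS.
Context {R : realType} {A : cstarType R}.

Lemma irreducible_cyclic (H : hilbertType R) (pi : A -> H -> H) (x : H) :
  irreducible pi -> x <> 0 -> closure [set pi a x | a in [set: A]] = setT.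
Proof.
move=> [rpi _ irr] x0.
have [|||V0|//] := irr (closure [set pi a x | a in [set: A]]).
- apply: subspace_closure; split; first by exists 0; rewrite // rep0.
  move=> c _ _ [a _ <-] [b _ <-]; exists (c *: a + b) => //.
  exact: (rep_linear rpi).
- exact: closed_closure.
- move=> a; apply: continuous_image_closure; first exact: (rep_op_bounded rpi).
  move=> _ [b _ <-]; apply: subset_closure; exists (a ** b) => //.
  exact: (rep_mul rpi).
- have : closure [set pi a x | a in [set: A]] x.
    by apply: subset_closure; exists cone => //; exact: (rep_one rpi).
  by rewrite V0.
Qed.

Section Graph.
Variables (H H' : hilbertType R) (pi : A -> H -> H) (pi' : A -> H' -> H').
Variables (Omega : H) (Omega' : H').
Hypotheses (rpi : representation pi) (rpi' : representation pi').
Hypothesis same_state : vector_state pi Omega = vector_state pi' Omega'.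

Definition orbit_graph : set (H * H') :=
  closure [set (pi a Omega, pi' a Omega') | a in [set: A]].

Lemma orbit_norm a : `|pi a Omega| = `|pi' a Omega'|.
Proof.
apply/eqP; rewrite -(@eqrXn2 _ 2)//; apply/eqP.
rewrite !rep_norm_sqr//; exact: (congr1 (fun f => f (star a ** a)) same_state).
Qed.

Lemma subspace_orbit_graph : subspace orbit_graph.
Proof.
apply: subspace_closure; split; first by exists 0; rewrite // !rep0.
move=> c _ _ [a _ <-] [b _ <-]; exists (c *: a + b) => //.
by rewrite (rep_linear rpi) (rep_linear rpi').
Qed.

Lemma orbit_graph_norm p : orbit_graph p -> `|p.1| = `|p.2|.
Proof.
move=> Gp; apply/eqP; rewrite -subr_eq0; apply/eqP.
suff : closure [set (0 : (Cplx R)^o)] (`|p.1| - `|p.2|).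
  rewrite -(closure_id _).1//; apply: accessible_closed_set1.
  exact: hausdorff_accessible (@norm_hausdorff _ _).
move: p Gp; apply: continuous_image_closure.
  move=> p; apply: cvgB; apply: cvg_norm; [exact: cvg_fst|exact: cvg_snd].
by move=> _ [a _ <-]; apply: subset_closure; rewrite /= orbit_norm subrr.
Qed.

Lemma orbit_graph_act a p : orbit_graph p -> orbit_graph (pi a p.1, pi' a p.2).
Proof.
move: p; apply: continuous_image_closure.
  move=> p; apply: cvg_pair.
    by apply: (cvg_comp fst (pi a)); [exact: cvg_fst|exact: (rep_op_bounded rpi)].
  by apply: (cvg_comp snd (pi' a)); [exact: cvg_snd|exact: (rep_op_bounded rpi')].
move=> _ [b _ <-]; apply: subset_closure; exists (a ** b) => //.
by rewrite (rep_mul rpi) (rep_mul rpi').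
Qed.

(** The values [pi' a Omega'] along the [a] with [pi a Omega] close to [x] form
    a Cauchy filter because [pi a Omega |-> pi' a Omega'] is isometric; its
    limit is the partner of [x]. *)
Lemma orbit_graph_total x : closure [set pi a Omega | a in [set: A]] x ->
  exists y, orbit_graph (x, y).
Proof.
move=> /closureP cx.
(* The neighbourhood filter of [x], pulled back to [A] along the orbit map. *)
pose F := filter_from [set e : Cplx R | 0 < e]
  (fun e => [set a | `|x - pi a Omega| < e]).
have FF : ProperFilter F.
  apply: filter_from_proper; last first.
    by move=> e /cx[_ [a _ <-]] xa; exists a.
  apply: filter_from_filter; first by exists 1 => /=.
  move=> e f /= e0 f0.
  have /orP[ef|fe] := real_leVge (gtr0_real e0) (gtr0_real f0).
    by exists e => // a /= xa; split=> //; exact: lt_le_trans ef.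
  by exists f => // a /= xa; split=> //; exact: lt_le_trans fe.
have Fx : (fun a => pi a Omega) @ F --> x.
  by apply/cvgrPdist_lt => e e0; exists e.
have : cvg ((fun a => pi' a Omega') @ F).
  apply: cauchy_cvg; apply: cauchy_exP => e e0.
  have e20 : 0 < e / 2 by rewrite divr_gt0.
  have [_ [a _ <-] xa] := cx _ e20.
  exists (pi' a Omega'); exists (e / 2) => // b /= xb.
  rewrite -ball_normE /= -repN// -repD// -orbit_norm// repD// repN//.
  have -> : pi a Omega - pi b Omega = (x - pi b Omega) - (x - pi a Omega).
    by rewrite opprB [RHS]addrC addrA subrK.
  by rewrite (le_lt_trans (ler_normB _ _))// [ltRHS]splitr ltrD.
case/cvg_ex => y Fy; exists y.
have Fxy : (pi a Omega, pi' a Omega') @[a --> F] --> (x, y) by exact: cvg_pair.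
apply: (closed_cvg orbit_graph _ _ _ Fxy).
  exact: closed_closure.
by apply: nearW => a; apply: subset_closure; exists a.
Qed.

End Graph.

Lemma GNS_unique (omega : A -> Cplx R) (H H' : hilbertType R)
    (pi : A -> H -> H) (pi' : A -> H' -> H') (Omega : H) (Omega' : H') :
  is_GNS omega pi Omega -> is_GNS omega pi' Omega' -> unitarily_equivalent pi pi'.
Proof.
move=> [rpi cyc om] [rpi' cyc' om'].
have same : vector_state pi Omega = vector_state pi' Omega'.
  by apply/funext => a; rewrite /vector_state -om -om'.
pose G := orbit_graph pi pi' Omega Omega'.
have Gnorm := @orbit_graph_norm _ _ _ _ _ _ rpi rpi' same.
have sG : subspace G by exact: subspace_orbit_graph.
have total x : exists y, G (x, y).
  by apply: orbit_graph_total => //; rewrite cyc.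
have surj y : exists x, G (x, y).
  have [|x] := @orbit_graph_total _ _ pi' pi Omega' Omega rpi' rpi (esym same) y.
    by rewrite cyc'.
  move=> Gyx; exists x; move: Gyx.
  apply: (continuous_image_closure (f := fun p => (p.2, p.1))) (y, x).
    by move=> p; apply: cvg_pair; [exact: cvg_snd|exact: cvg_fst].
  by move=> _ [a _ <-]; apply: subset_closure; exists a.
have GB x x' y y' : G (x, y) -> G (x', y') -> G (x' - x, y' - y).
  move=> Gxy Gxy'; have := sG.2 (-1) _ _ Gxy Gxy'.
  by rewrite scaleN1r addrC.
have graph_fun x y y' : G (x, y) -> G (x, y') -> y = y'.
  move=> h h'; have /= := Gnorm _ (GB _ _ _ _ h' h).
  rewrite subrr normr0 => /esym yy.
  by apply/eqP; rewrite -subr_eq0 -normr_eq0 yy.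
have graph_inj x x' y : G (x, y) -> G (x', y) -> x = x'.
  move=> h h'; have /= := Gnorm _ (GB _ _ _ _ h' h).
  rewrite subrr normr0 => xx.
  by apply/eqP; rewrite -subr_eq0 -normr_eq0 xx.
have [U GU] := choice total; have [V GV] := choice surj.
have linU : linear U.
  by move=> c x y; apply: graph_fun (GU _) _; exact: (sG.2 c _ _ (GU x) (GU y)).
exists U; split=> //.
- exists V => [x|y]; first exact: graph_inj (GV _) (GU _).
  exact: graph_fun (GU _) (GV _).
- by apply: isometry_dot => // x; rewrite (Gnorm _ (GU x)).
- move=> a x; apply: graph_fun (GU _) _.
  exact: (@orbit_graph_act _ _ _ _ _ _ rpi rpi' a _ (GU x)).
Qed.

(** * Kappa of an irreducible representation *)

Lemma unitarily_equivalent_sym (H H' : hilbertType R)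
    (pi : A -> H -> H) (pi' : A -> H' -> H') :
  unitarily_equivalent pi pi' -> unitarily_equivalent pi' pi.
Proof.
move=> [U [linU [V UV VU] dU Upi]]; exists V; split.
- by move=> c x y; apply: (can_inj UV); rewrite VU linU !VU.
- by exists U.
- by move=> x y; rewrite -dU !VU.
- by move=> a x; apply: (can_inj UV); rewrite VU Upi VU.
Qed.

Lemma unitarily_equivalent_trans (H H' H'' : hilbertType R)
    (pi : A -> H -> H) (pi' : A -> H' -> H') (pi'' : A -> H'' -> H'') :
  unitarily_equivalent pi pi' -> unitarily_equivalent pi' pi'' ->
  unitarily_equivalent pi pi''.
Proof.
move=> [U [linU bU dU Upi]] [V [linV bV dV Vpi]]; exists (V \o U); split.
- by move=> c x y; rewrite /= linU linV.
- exact: bij_comp.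
- by move=> x y; rewrite /= dV dU.
- by move=> a x; rewrite /= Upi Vpi.
Qed.

Lemma irreducible_GNS (H : hilbertType R) (pi : A -> H -> H) (x : H) :
  irreducible pi -> `|x| = 1 -> is_GNS (vector_state pi x) pi x.
Proof.
move=> ipi x1; split=> //; first by case: ipi.
by apply: irreducible_cyclic => // x0; move/eqP: x1; rewrite x0 normr0 eq_sym oner_eq0.
Qed.

(** This makes [kappa_rep pi] independent of the unit vector it selects, and of
    [pi] within its unitary equivalence class. *)
Lemma state_equiv_irreducible (H : hilbertType R) (pi : A -> H -> H) (x : H)
    (omega : A -> Cplx R) : irreducible pi -> `|x| = 1 ->
  state_equiv omega (vector_state pi x) <->
  exists (H1 : hilbertType R) (pi1 : A -> H1 -> H1) (Omega1 : H1),
    is_GNS omega pi1 Omega1 /\ unitarily_equivalent pi1 pi.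
Proof.
move=> ipi x1; split=> [[H1 [H2 [pi1 [pi2 [v1 [v2 [G1 G2 e12]]]]]]]|].
  exists H1, pi1, v1; split=> //.
  apply: (unitarily_equivalent_trans e12).
  by apply: (GNS_unique G2); exact: irreducible_GNS.
move=> [H1 [pi1 [v1 [G1 eq1]]]]; exists H1, H, pi1, pi, v1, x; split=> //.
exact: irreducible_GNS.
Qed.

Lemma irreducible_unit_vector (H : hilbertType R) (pi : A -> H -> H) :
  irreducible pi -> `|xget 0 [set x : H | `|x| = 1]| = 1.
Proof.
move=> [_ [x /eqP x0] _].
have x1 : [set x : H | `|x| = 1] (`|x|^-1 *: x) by exact: normfZV.
by have /= := xgetI 0 x1.
Qed.

Section Kappa.
Variables (n : option nat) (s : cuntz_index n -> A).

Lemma eq_kappa (omega omega' : A -> Cplx R) :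
  (forall w, is_state w -> (state_equiv w omega <-> state_equiv w omega')) ->
  kappa s omega = kappa s omega'.
Proof.
move=> E; rewrite /kappa; congr (xget None (is_min_enat _)).
apply: (congr1 (fun X => cdim s @` X)); apply/seteqP.
by split=> w /= [sw /(E _ sw)].
Qed.

Lemma kappa_rep_unitarily_equivalent (H H' : hilbertType R)
    (pi : A -> H -> H) (pi' : A -> H' -> H') :
  irreducible pi -> irreducible pi' -> unitarily_equivalent pi pi' ->
  kappa_rep s pi = kappa_rep s pi'.
Proof.
move=> ipi ipi' e; apply: eq_kappa => w _.
have x1 := irreducible_unit_vector ipi; have x1' := irreducible_unit_vector ipi'.
rewrite !state_equiv_irreducible//.
split=> -[H1 [pi1 [v1 [G1 e1]]]]; exists H1, pi1, v1; split=> //.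
  exact: unitarily_equivalent_trans e.
by apply: (unitarily_equivalent_trans e1); exact: unitarily_equivalent_sym.
Qed.

End Kappa.
End GNS.

(** * Composition with automorphisms *)

Section Automorphism.
Context {R : realType} {A : cstarType R}.

Lemma star_automorphism_inverse (f : A -> A) : star_automorphism f ->
  exists g, [/\ star_automorphism g, cancel f g & cancel g f].
Proof.
move=> [[linf f1 fM fS] [g fg gf]]; exists g; split=> //; split; last by exists f.
split.
- by move=> c x y; apply: (can_inj fg); rewrite gf linf !gf.
- by apply: (can_inj fg); rewrite gf f1.
- by move=> a b; apply: (can_inj fg); rewrite gf fM !gf.
- by move=> a; apply: (can_inj fg); rewrite gf fS gf.
Qed.

Lemma representation_comp (f : A -> A) (H : hilbertType R) (pi : A -> H -> H) :
  star_morphism f -> representation pi -> representation (fun a => pi (f a)).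
Proof.
move=> [linf f1 fM fS] rpi; split.
- by move=> a; exact: (rep_op_linear rpi).
- by move=> a; exact: (rep_op_bounded rpi).
- by move=> c a b x; rewrite linf (rep_linear rpi).
- by move=> a b x; rewrite fM (rep_mul rpi).
- by move=> x; rewrite f1 (rep_one rpi).
- by move=> a x y; rewrite fS (rep_star rpi).
Qed.

Lemma is_GNS_comp (f : A -> A) (omega : A -> Cplx R) (H : hilbertType R)
    (pi : A -> H -> H) (Omega : H) : star_automorphism f ->
  is_GNS omega pi Omega -> is_GNS (omega \o f) (fun a => pi (f a)) Omega.
Proof.
move=> [fmor [g fg gf]] [rpi cyc om]; split.
- exact: representation_comp.
- rewrite -cyc; congr closure; apply/seteqP; split=> [_ [a _ <-]|_ [a _ <-]].
    by exists (f a).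
  by exists (g a); rewrite ?gf.
- by move=> a; rewrite /= om.
Qed.

Lemma state_equiv_comp (f : A -> A) (omega omega' : A -> Cplx R) :
  star_automorphism f -> state_equiv omega omega' ->
  state_equiv (omega \o f) (omega' \o f).
Proof.
move=> fauto [H [H' [pi [pi' [v [v' [G G' [U [linU bU dU Upi]]]]]]]]].
exists H, H', (fun a => pi (f a)), (fun a => pi' (f a)), v, v'.
split; [exact: is_GNS_comp|exact: is_GNS_comp|].
by exists U; split=> // a x; rewrite Upi.
Qed.

Lemma is_state_comp (f : A -> A) (omega : A -> Cplx R) :
  star_morphism f -> is_state omega -> is_state (omega \o f).
Proof.
move=> [linf f1 fM fS] [lino pos o1]; split.
- by move=> c a b; rewrite /= linf lino.
- by move=> a; rewrite /= fM fS.
- by rewrite /= f1.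
Qed.

Variables (n : option nat) (s : cuntz_index n -> A).
Hypothesis ss : orthonormal_isometries s.
Variable (g : unitary_group (Cplx R) n).
Variable alpha : A -> A.
Hypothesis ga : is_alpha s g alpha.

Lemma alpha_coefficients : has_unitary_coefficients s (alpha \o s).
Proof.
case: ga => _; case: n s ss g => [k|] s' ss' [g' gu] /= ae.
  exact: (@finite_coefficients _ _ _ _ (alpha \o s') g' ss' gu ae).
exact: (@infinite_coefficients _ _ _ (alpha \o s') g' ss' gu ae).
Qed.

(** [alpha] turns words in the [s i] into words in the isometries
    [alpha (s i)], which are related to the [s i] by unitary coefficients. *)
Lemma Kspace_alpha (H : hilbertType R) (pi : A -> H -> H) (Omega : H) :
  representation pi ->
  Kspace s (fun a => pi (alpha a)) Omega = Kspace s pi Omega.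
Proof.
case: ga => [[[linf f1 fM fS] _] _] rpi.
have f0 : alpha 0 = 0.
  by have := linf (-1) 0 0; rewrite scaler0 addr0 scaleN1r addNr.
have wordE J : alpha (word s J) = word (alpha \o s) J.
  elim: J => [|j J IH]; rewrite /word !(big_nil, big_cons)//.
  by rewrite fM; congr (_ ** _).
transitivity (Kspace (alpha \o s) pi Omega).
  rewrite /Kspace; congr (closure (lspan _)); apply/seteqP.
  by split=> _ [J _ <-]; exists J; rewrite // fS wordE.
have [c [st c1 c2]] := alpha_coefficients.
have tt : orthonormal_isometries (alpha \o s).
  by move=> i j /=; rewrite -fS -fM ss; case: ifP.
exact: (@Kspace_eq _ _ _ _ _ c _ _ Omega rpi ss tt st c1 c2).
Qed.

(** Composition with [alpha] is a bijection between the GNS triples of [omega]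
    and those of [omega \o alpha] that keeps the space [K], so both values are
    selected from the same set. *)
Lemma cdim_alpha (omega : A -> Cplx R) : cdim s (omega \o alpha) = cdim s omega.
Proof.
have [b [bauto ab ba]] := star_automorphism_inverse ga.1.
rewrite /cdim; congr (xget None); apply/seteqP; split=> d [H [pi [v [G ->]]]].
  exists H, (fun a => pi (b a)), v; split.
    have := is_GNS_comp bauto G.
    by rewrite (_ : _ \o _ = omega)//; apply/funext => a; rewrite /= ba.
  rewrite -(@Kspace_alpha _ (fun a => pi (b a))).
    by congr (hdim (Kspace s _ v)); apply/funext => a; rewrite ab.
  by apply: representation_comp; [case: bauto|case: G].
exists H, (fun a => pi (alpha a)), v; split; first exact: is_GNS_comp ga.1 G.
by rewrite Kspace_alpha//; case: G.
Qed.

Lemma kappa_alpha (omega : A -> Cplx R) : kappa s (omega \o alpha) = kappa s omega.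
Proof.
have [b [bauto ab ba]] := star_automorphism_inverse ga.1.
have baK (w : A -> Cplx R) : (w \o b) \o alpha = w.
  by apply/funext => a; rewrite /= ab.
have abK (w : A -> Cplx R) : (w \o alpha) \o b = w.
  by apply/funext => a; rewrite /= ba.
rewrite /kappa; congr (xget None (is_min_enat _)).
apply/seteqP; split=> _ [w [sw we] <-].
  exists (w \o b); last by rewrite -cdim_alpha baK.
  split; first by apply: is_state_comp sw; case: bauto.
  by have := state_equiv_comp bauto we; rewrite abK.
exists (w \o alpha); last exact: cdim_alpha.
split; first by apply: is_state_comp sw; case: ga.1.
exact: state_equiv_comp ga.1 we.
Qed.

End Automorphism.

Theorem proposition4p1 (R : realType) (n : option nat) (n_ge2 : le_enat (Some 2) n)
    (A : cstarType R) (s : cuntz_index n -> A) (As : is_cuntz_algebra s) :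
  (forall (H H' : hilbertType R) (pi : A -> H -> H) (pi' : A -> H' -> H'),
     irreducible pi -> irreducible pi' -> unitarily_equivalent pi pi' ->
     kappa_rep s pi = kappa_rep s pi')
  /\
  (forall (H : hilbertType R) (pi : A -> H -> H) (g : unitary_group (Cplx R) n)
          (alpha_g : A -> A),
     irreducible pi -> is_alpha s g alpha_g ->
     kappa_rep s (fun a => pi (alpha_g a)) = kappa_rep s pi).
Proof.
have [[ss _] _ _] := As.
split; first exact: kappa_rep_unitarily_equivalent.
move=> H pi g alpha_g _ ga.
exact: (kappa_alpha ss ga).
Qed.
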